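(* Let $R$ be a $2$-torsion free semiprime ring and let $U$ be a nonzero square closed Lie ideal of $R$. Suppose that $f: R\to R$ is a ring endomorphism of $R$ such that $f(U)=U$. Then $f$ is strong commutativity preserving on $U$ if and only if $f$ is centralizing on $U$.
   Context: All rings are associative with identity (not necessarily commutative); $Z(R)$ is the center of $R$ and $[x,y]=xy-yx$. $R$ is $2$-torsion free if $2x=0$ implies $x=0$ for $x\in R$. $R$ is semiprime if, for $a\in R$, $aRa=0$ implies $a=0$. A Lie ideal of $R$ is an additive subgroup $U$ of $R$ with $[u,r]\in U$ for all $u\in U$, $r\in R$; it is square closed if moreover $u^2\in U$ for all $u\in U$. An endomorphism of $R$ is an additive map $f:R\to R$ with $f(xy)=f(x)f(y)$ for all $x,y\in R$. For a subset $S\subseteq R$, a map $f:R\to R$ is centralizing on $S$ if $[f(x),x]\in Z(R)$ for all $x\in S$, and is strong commutativity preserving on $S$ if $[f(x),f(y)]=[x,y]$ for all $x,y\in S$. *)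

(* Defs.v *)
From HB Require Import structures.
From mathcomp Require Import all_boot all_order all_algebra.
From mathcomp Require Import all_classical.

Set Implicit Arguments.
Unset Strict Implicit.
Unset Printing Implicit Defensive.

Import GRing.Theory.
Local Open Scope classical_set_scope.
Local Open Scope ring_scope.

(* Rings are [pzRingType]s: associative and unital, not necessarily
   commutative, the zero ring being allowed. *)

Definition lie_bracket (R : pzRingType) (x y : R) : R := x * y - y * x.

Definition center (R : pzRingType) : set R :=
  [set z | forall x : R, GRing.comm z x].

Definition two_torsion_free (R : pzRingType) : Prop :=
  forall x : R, x *+ 2 = 0 -> x = 0.

Definition semiprime (R : pzRingType) : Prop :=
  forall a : R, (forall x : R, a * x * a = 0) -> a = 0.

Definition lie_ideal (R : pzRingType) (U : set R) : Prop :=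
  GRing.zmod_closed (mem U) /\
  (forall u r : R, U u -> U (lie_bracket u r)).

Definition square_closed (R : pzRingType) (U : set R) : Prop :=
  forall u : R, U u -> U (u ^+ 2).

Definition centralizing_on (R : pzRingType) (S : set R) (f : R -> R) : Prop :=
  forall x : R, S x -> center (lie_bracket (f x) x).

Definition scp_on (R : pzRingType) (S : set R) (f : R -> R) : Prop :=
  forall x y : R, S x -> S y -> lie_bracket (f x) (f y) = lie_bracket x y.

(* Main.v *)
(* Since 2uv = (uv + vu) + [u, v], a square closed Lie ideal U satisfies
   2UU <= U, hence 2R[U,U]R <= U.  Write d = f x - x.  If d U [d, w] = 0 with
   d, w in U, then c = [d, w] satisfies c U c = 0, so c R c R c = 0 and c = 0
   by semiprimeness.
   If f is strong commutativity preserving, replacing y by 2xy gives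
   d [x, y] = 0, then replacing y by 2yz gives d U [x, U] = 0, so [d, x] = 0.
   If f is centralizing, linearizing at (x, x^2) gives [f x, x]^2 = 0, so
   [f x, x] = 0; linearizing again, [f x, y] = [x, f y].  Replacing y by 2xy
   and using f(U) = U gives d U [x, U] = 0 = d U [f x, U], so [d, U] = 0, that
   is [f x, z] = [x, z], whence [f x, f z] = [x, f z] = [f x, z] = [x, z]. *)
Require Import Defs.
From HB Require Import structures.
From mathcomp Require Import all_boot all_order all_algebra.
From mathcomp Require Import all_classical.

Set Implicit Arguments.
Unset Strict Implicit.
Unset Printing Implicit Defensive.

Import GRing.Theory.
Local Open Scope classical_set_scope.
Local Open Scope ring_scope.

Section LieBracket.
Variable R : pzRingType.
Implicit Types x y z : R.

Local Notation "{[ x , y ]}" := (lie_bracket x y).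

Lemma lie_xx x : {[x, x]} = 0.
Proof. exact: subrr. Qed.

Lemma lieC x y : {[x, y]} = - {[y, x]}.
Proof. by rewrite /lie_bracket opprB. Qed.

Lemma lieDl x y z : {[x + y, z]} = {[x, z]} + {[y, z]}.
Proof. by rewrite /lie_bracket mulrDl mulrDr opprD addrACA. Qed.

Lemma lieNl x y : {[- x, y]} = - {[x, y]}.
Proof. by rewrite /lie_bracket mulNr mulrN opprD. Qed.

Lemma lieBl x y z : {[x - y, z]} = {[x, z]} - {[y, z]}.
Proof. by rewrite lieDl lieNl. Qed.

Lemma lieDr x y z : {[x, y + z]} = {[x, y]} + {[x, z]}.
Proof. by rewrite lieC lieDl opprD -!lieC. Qed.

Lemma lieMnr x y n : {[x, y *+ n]} = {[x, y]} *+ n.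
Proof. by rewrite /lie_bracket mulrnAr mulrnAl mulrnBl. Qed.

Lemma lieMr x y z : {[x, y * z]} = {[x, y]} * z + y * {[x, z]}.
Proof. by rewrite /lie_bracket mulrBl mulrBr !mulrA addrA subrK. Qed.

Lemma lieMl x y z : {[x * y, z]} = x * {[y, z]} + {[x, z]} * y.
Proof. by rewrite lieC lieMr opprD -mulNr -mulrN -!lieC addrC. Qed.

Lemma center_lie z x : center z -> {[z, x]} = 0.
Proof. by move=> zC; apply/eqP; rewrite subr_eq0; apply/eqP; exact: zC. Qed.

End LieBracket.

Local Notation "{[ x , y ]}" := (lie_bracket x y).

Section SquareClosedLieIdeal.
Variables (R : pzRingType) (U : set R).
Hypotheses (R2 : two_torsion_free R) (Rsp : semiprime R).
Hypotheses (ULie : lie_ideal U) (Usq : square_closed U).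

Lemma lie_idealB u v : U u -> U v -> U (u - v).
Proof.
by have [[_ UB] _] := ULie => Uu Uv; apply/set_mem; apply: UB; apply/mem_set.
Qed.

Lemma lie_ideal_lie u r : U u -> U {[u, r]}.
Proof. by have [_] := ULie; apply. Qed.

Lemma lie_idealD u v : U u -> U v -> U (u + v).
Proof.
move=> Uu Uv; rewrite -[v]opprK; apply: lie_idealB => //.
by rewrite -sub0r; apply: lie_idealB => //; rewrite -(subrr u); apply: lie_idealB.
Qed.

Lemma square_closed_double_mul u v : U u -> U v -> U ((u * v) *+ 2).
Proof.
move=> Uu Uv.
have -> : (u * v) *+ 2 = ((u + v) ^+ 2 - u ^+ 2 - v ^+ 2) + {[u, v]}.
  rewrite /lie_bracket !expr2 mulrDl !mulrDr mulr2n !addrA.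
  rewrite [u * u + _ + _ + _ - _]addrC !addrA addNr add0r addrK.
  by rewrite addrAC addrK.
apply: lie_idealD; last exact: lie_ideal_lie.
by do !apply: lie_idealB; apply: Usq => //; apply: lie_idealD.
Qed.

(** Doubling [[u, v] t = [u, v t] - v [u, t]] places [2 [u, v] t] in [U]; a bracket with [r] then
    supplies the factor on the left. *)
Lemma square_closed_double_lie_ideal u v r s :
  U u -> U v -> U ((r * {[u, v]} * s) *+ 2).
Proof.
move=> Uu Uv.
have right t : U (({[u, v]} * t) *+ 2).
  have -> : {[u, v]} * t *+ 2 = {[u, v * t]} *+ 2 - (v * {[u, t]}) *+ 2.
    by rewrite lieMr mulrnDl addrK.
  apply: lie_idealB.
    by rewrite mulr2n; apply: lie_idealD; apply: lie_ideal_lie.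
  by apply: square_closed_double_mul => //; apply: lie_ideal_lie.
have -> : r * {[u, v]} * s *+ 2
    = ({[u, v]} * (s * r)) *+ 2 - {[({[u, v]} * s) *+ 2, r]}.
  by rewrite [in RHS]/lie_bracket mulrnAl mulrnAr !mulrA opprB addrC subrK.
by apply: lie_idealB => //; apply: lie_ideal_lie.
Qed.

Lemma lie_eq0_of_annihilator d w : U d -> U w ->
  (forall y, U y -> d * y * {[d, w]} = 0) -> {[d, w]} = 0.
Proof.
move=> Ud Uw dUc; set c := {[d, w]} in dUc *.
have cUc y : U y -> c * y * c = 0.
  move=> Uy; apply: R2.
  (* The left [c] is expanded as [d w - w d]; the factor 2 is there because [2 w y], not [w y], is
     known to lie in [U]. *)
  have -> : c * y * c *+ 2 = d * (w * y *+ 2) * c - w * (d * y * c) *+ 2.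
    by rewrite mulrnAr mulrnAl -mulrnBl {1}/c /lie_bracket !mulrBl !mulrA.
  rewrite dUc ?dUc // ?mulr0 ?mul0rn ?subr0 //.
  exact: square_closed_double_mul.
have cRcRc r s : c * r * c * s * c = 0.
  apply: R2; rewrite -mulrnAl -mulrA -mulrA.
  have := cUc _ (square_closed_double_lie_ideal r s Ud Uw).
  by rewrite -/c !mulrnAr !mulrnAl !mulrA.
(* The second use of semiprimeness is for [c r c]: the product [c r c s c r c] starts with
   [c r c s c]. *)
apply: Rsp => r; apply: Rsp => s.
by rewrite !mulrA cRcRc !mul0r.
Qed.

(** In [d [x, 2yz]] the term [2 d [x, y] z] vanishes by hypothesis, leaving [2 d y [x, z]]. *)
Lemma annihilator_lie_spread d x :
  (forall z, U z -> d * {[x, z]} = 0) ->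
  forall y z, U y -> U z -> d * y * {[x, z]} = 0.
Proof.
move=> dxU y z Uy Uz; apply: R2.
have := dxU _ (square_closed_double_mul Uy Uz).
by rewrite lieMnr lieMr mulrnAr mulrDr !mulrA dxU // mul0r add0r.
Qed.

Variable f : {additive R -> R}.
Hypotheses (fM : {morph f : x y / x * y}) (fU : f @` U = U).

Lemma image_in x : U x -> U (f x).
Proof. by move=> Ux; rewrite -fU; exists x. Qed.

Lemma scp_commuting x : scp_on U f -> U x -> {[f x, x]} = 0.
Proof.
move=> scp Ux; set d := f x - x.
have Ud : U d by apply: lie_idealB => //; apply: image_in.
have dxU y : U y -> d * {[x, y]} = 0.
  move=> Uy; apply: R2.
  (* [[f x, f (2xy)] = 2 (f x) [x, y]] and [[x, 2xy] = 2 x [x, y]] differ by [2 d [x, y]]. *)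
  have := scp _ _ Ux (square_closed_double_mul Ux Uy).
  rewrite raddfMn fM !lieMnr !lieMr !lie_xx !mul0r !add0r scp // => E.
  by rewrite /d mulrBl mulrnBl E subrr.
have dUxU := annihilator_lie_spread dxU.
have : {[d, x]} = 0.
  apply: lie_eq0_of_annihilator => // y Uy.
  (* Since [d] lies in [U], [dUxU] applies with [z := d]. *)
  by rewrite lieC mulrN dUxU // oppr0.
by rewrite /d lieBl lie_xx subr0.
Qed.

Lemma centralizing_commuting x : centralizing_on U f -> U x -> {[f x, x]} = 0.
Proof.
move=> fC Ux; set c := {[f x, x]}.
have cC y : c * y = y * c by apply: (fC _ Ux).
have Ux2 : U (x * x) by rewrite -expr2; apply: Usq.
have lie0 y : U y -> {[ {[f x, y]} + {[f y, x]}, x]} = 0.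
  move=> Uy; have := center_lie x (fC _ (lie_idealD Ux Uy)).
  have -> : {[f (x + y), x + y]}
      = {[f x, x]} + {[f y, y]} + ({[f x, y]} + {[f y, x]}).
    by rewrite raddfD lieDl !lieDr [{[f y, x]} + _]addrC addrACA.
  rewrite lieDl (lieDl {[f x, x]}) (center_lie x (fC _ Ux)).
  by rewrite (center_lie x (fC _ Uy)) !add0r.
(* For [y = x * x], centrality of [c] turns the sum in [lie0] into [2 c x + 2 c (f x)], whose
   bracket with [x] is [2 c c]. *)
have c2 : c * c = 0.
  apply: R2; have := lie0 _ Ux2.
  rewrite fM lieMr lieMl -/c -cC -(cC (f x)) !lieDl !lieMl lie_xx -/c.
  by rewrite (center_lie x (fC _ Ux)) !(mul0r, mulr0, addr0, add0r) mulr2n.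
by apply: Rsp => r; rewrite cC -mulrA c2 mulr0.
Qed.

Lemma commuting_scp : (forall x, U x -> {[f x, x]} = 0) -> scp_on U f.
Proof.
move=> fC.
have swap x y : U x -> U y -> {[f x, y]} = {[x, f y]}.
  move=> Ux Uy; have := fC _ (lie_idealD Ux Uy).
  rewrite raddfD lieDl !lieDr !fC // add0r addr0 => /eqP.
  by rewrite addr_eq0 -lieC => /eqP.
suff eql x z : U x -> U z -> {[f x, z]} = {[x, z]}.
  by move=> x z Ux Uz; rewrite (eql _ _ Ux (image_in Uz)) -swap // eql.
move=> Ux Uz; set d := f x - x.
have Ud : U d by apply: lie_idealB => //; apply: image_in.
have dfxU y : U y -> d * {[f x, y]} = 0.
  move=> Uy; apply: R2.
  (* The two sides become [2 x [f x, y]] and [2 (f x) [x, f y]], and [swap] turns the last bracket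
     into [[f x, y]]. *)
  have := swap _ _ Ux (square_closed_double_mul Ux Uy).
  rewrite raddfMn fM !lieMnr !lieMr fC // (lieC x (f x)) fC //.
  rewrite oppr0 !mul0r !add0r -swap // => E.
  by rewrite /d mulrBl mulrnBl E subrr.
have dxU y : U y -> d * {[x, y]} = 0.
  (* Surjectivity of [f] on [U] enters here: with [y = f w], [[x, y] = [f x, w]]. *)
  by rewrite -{1}fU => -[w Uw <-]; rewrite -swap // dfxU.
have : {[d, z]} = 0.
  apply: lie_eq0_of_annihilator => // y Uy; rewrite {2}/d lieBl mulrBr.
  by rewrite (annihilator_lie_spread dfxU) // (annihilator_lie_spread dxU) // subr0.
by rewrite /d lieBl => /eqP; rewrite subr_eq0 => /eqP.
Qed.

End SquareClosedLieIdeal.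

Theorem theorem1 (R : pzRingType) (U : set R) (f : {additive R -> R})
    (R2 : two_torsion_free R) (Rsp : semiprime R)
    (ULie : lie_ideal U) (Usq : square_closed U) (Unz : U <> [set 0])
    (fM : {morph f : x y / x * y}) (fU : f @` U = U) :
  scp_on U f <-> centralizing_on U f.
Proof.
split=> [scp x Ux y | fC].
  by rewrite (scp_commuting R2 Rsp ULie Usq fM fU) // /GRing.comm mul0r mulr0.
apply: (commuting_scp R2 Rsp ULie Usq fM fU) => x Ux.
exact: (centralizing_commuting R2 Rsp ULie Usq fM).
Qed.
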